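(* Let $(S,\cdot,{}^{-1})$ be an inverse semigroup satisfying the identity $x^n\approx x^{n+1}$ for some positive integer $n$. Define a binary operation $\oplus$ on $S$ by \[ x\oplus y:=(xy^{-1})^n x . \] Then $S$, with addition $\oplus$ and multiplication $\cdot$, is an additively idempotent semiring.
   Context: Elements $x,y$ of a semigroup $(S,\cdot)$ are inverses of each other if $xyx=x$ and $yxy=y$. A semigroup is inverse if each of its elements $x$ has a unique inverse, denoted $x^{-1}$; inverse semigroups are regarded as algebras $(S,\cdot,{}^{-1})$ of type $(2,1)$. Satisfying the identity $x^n\approx x^{n+1}$ means that $a^n=a^{n+1}$ for all $a\in S$. An additively idempotent semiring is an algebra $(S,+,\cdot)$ of type $(2,2)$ such that the additive reduct $(S,+)$ is a semilattice (that is, a commutative idempotent semigroup), the multiplicative reduct $(S,\cdot)$ is a semigroup, and multiplication distributes over addition on the left and on the right, that is, $x(y+z)=xy+xz$ and $(y+z)x=yx+zx$ for all $x,y,z\in S$. *)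

(* Defs.v *)
From mathcomp Require Import all_boot.

Set Implicit Arguments.
Unset Strict Implicit.
Unset Printing Implicit Defensive.

(* Carriers are arbitrary types with explicit operations: [semigroupType]
   would additionally impose a [choiceType] structure. *)

Definition mutually_inverse (S : Type) (mul : S -> S -> S) (x y : S) : Prop :=
  mul (mul x y) x = x /\ mul (mul y x) y = y.

(* [unique P a] means that [P a] holds and any [b] with [P b] equals [a]. *)
Record is_inverse_semigroup (S : Type) (mul : S -> S -> S) (inv : S -> S) :
    Prop := InverseSemigroup {
  inverse_semigroup_mulA : associative mul;
  inverse_semigroup_inv : forall x, unique (mutually_inverse mul x) (inv x)
}.

(* A semigroup has no empty product, so this is the power x^n only for
   0 < n; the value at n = 0 is the junk value x. *)
Definition spow (S : Type) (mul : S -> S -> S) (x : S) (n : nat) : S :=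
  iterop n mul x x.

Record is_semilattice (S : Type) (add : S -> S -> S) : Prop := Semilattice {
  semilattice_addA : associative add;
  semilattice_addC : commutative add;
  semilattice_addxx : idempotent_op add
}.

(* Neither a zero nor a one is required. *)
Record is_ai_semiring (S : Type) (add mul : S -> S -> S) : Prop := AiSemiring {
  ai_semiring_add : is_semilattice add;
  ai_semiring_mulA : associative mul;
  ai_semiring_mulDr : right_distributive mul add;
  ai_semiring_mulDl : left_distributive mul add
}.

Definition oplus (S : Type) (mul : S -> S -> S) (inv : S -> S) (n : nat)
    (x y : S) : S :=
  mul (spow mul (mul x (inv y)) n) x.

(* Main.v *)
(* The natural partial order of [S] puts [x] below [y] when [x = e y] for some
   idempotent [e].  Put [p = (x y^-1)^n]; by aperiodicity [p] is an idempotent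
   absorbing [x y^-1], and [p x] is the greatest lower bound of [x] and [y].
   Hence the sum is the meet of a semilattice.  Translations are monotone, and
   [a^-1 t <= b] whenever [t <= a b], so they also preserve meets. *)
Require Import Defs.
From mathcomp Require Import all_boot.

Set Implicit Arguments.
Unset Strict Implicit.
Unset Printing Implicit Defensive.

Section InverseSemigroup.

Context {S : Type} {mul : S -> S -> S} {inv : S -> S}.
Hypothesis inverse_S : is_inverse_semigroup mul inv.

Local Notation "x * y" := (mul x y).
Local Notation "x ^-1" := (inv x).

Let mulA : associative mul := inverse_semigroup_mulA inverse_S.

Lemma mulVK x : x * x^-1 * x = x.
Proof. by case: (inverse_semigroup_inv inverse_S x) => -[]. Qed.

Lemma mulKV x : x^-1 * x * x^-1 = x^-1.
Proof. by case: (inverse_semigroup_inv inverse_S x) => -[]. Qed.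

Lemma inv_eq x y : x * y * x = x -> y * x * y = y -> x^-1 = y.
Proof.
by move=> xyx yxy; case: (inverse_semigroup_inv inverse_S x) => _; apply.
Qed.

Lemma invK : involutive inv.
Proof. by move=> x; apply: inv_eq; [apply: mulKV | apply: mulVK]. Qed.

Definition idem e := e * e = e.

Lemma idem_inv e : idem e -> e^-1 = e.
Proof. by move=> ee; apply: inv_eq; rewrite !ee. Qed.

Lemma idem_mulV x : idem (x * x^-1).
Proof. by rewrite /idem mulA mulVK. Qed.

Lemma idem_Vmul x : idem (x^-1 * x).
Proof. by rewrite /idem mulA mulKV. Qed.

(* The inverse of [e f] is [f z e] with [z = (e f)^-1], which is idempotent. *)
Lemma idemM e f : idem e -> idem f -> idem (e * f).
Proof.
move=> ee ff; set z := (e * f)^-1.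
have zE : z = f * z * e.
  apply: inv_eq.
    rewrite -!mulA (mulA f f) ff (mulA e e) ee.
    by have := mulVK (e * f); rewrite -!mulA.
  rewrite -!mulA (mulA e e) ee (mulA f f) ff.
  by have := mulKV (e * f); rewrite -/z => zz; rewrite -{3}zz !mulA.
have zz : idem z.
  rewrite /idem {1 2}zE.
  have := mulKV (e * f); rewrite -/z => zfz.
  by rewrite {3}zE -{3}zfz !mulA.
by have := idem_inv zz; rewrite invK => ->.
Qed.

(** The product [e * f] is idempotent, hence its own inverse, and [f * e] is an inverse of it too;
    uniqueness of inverses identifies them. *)
Lemma idemC e f : idem e -> idem f -> e * f = f * e.
Proof.
move=> ee ff; rewrite -[LHS](idem_inv (idemM ee ff)).
apply: inv_eq.
  rewrite -!mulA (mulA f f) ff (mulA e e) ee.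
  by have := idemM ee ff; rewrite /idem -!mulA.
rewrite -!mulA (mulA e e) ee (mulA f f) ff.
by have := idemM ff ee; rewrite /idem -!mulA.
Qed.

(** The idempotents [x^-1 * x] and [y * y^-1] meet in the middle of both inverse laws; swapping them
    lets each factor cancel. *)
Lemma invM x y : (x * y)^-1 = y^-1 * x^-1.
Proof.
have C := idemC (idem_Vmul x) (idem_mulV y).
apply: inv_eq.
  transitivity (x * ((y * y^-1) * (x^-1 * x)) * y); first by rewrite !mulA.
  by rewrite -C !mulA mulVK -!mulA (mulA y) mulVK.
transitivity (y^-1 * ((x^-1 * x) * (y * y^-1)) * x^-1); first by rewrite !mulA.
by rewrite C !mulA mulKV -!mulA (mulA x^-1) mulKV.
Qed.

Definition nle x y := exists2 e, idem e & x = e * y.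

Lemma nle_refl x : nle x x.
Proof. by exists (x * x^-1); [apply: idem_mulV | rewrite mulVK]. Qed.

Lemma nle_trans y x z : nle x y -> nle y z -> nle x z.
Proof.
move=> [e ee ->] [f ff ->]; exists (e * f); first exact: idemM.
by rewrite mulA.
Qed.

Lemma nle_anti x y : nle x y -> nle y x -> x = y.
Proof.
move=> [e ee xE] [f ff yE].
have ex : e * x = x by rewrite xE mulA ee.
by rewrite xE yE mulA (idemC ee ff) -mulA ex.
Qed.

Lemma nle_mul2r z x y : nle x y -> nle (x * z) (y * z).
Proof. by move=> [e ee ->]; exists e => //; rewrite mulA. Qed.

Lemma idem_conj z e : idem e -> idem (z * e * z^-1).
Proof.
move=> ee; rewrite /idem.
transitivity (z * (e * (z^-1 * z)) * e * z^-1); first by rewrite !mulA.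
rewrite (idemC ee (idem_Vmul z)) !mulA mulVK.
by rewrite -(mulA z e e) ee.
Qed.

(** Commuting [e] past [z^-1 * z] moves an idempotent from the right of [z] to its left, as a
    conjugate. This makes the one-sided definition of [nle] compatible with left translations. *)
Lemma mul_idem_conj z e : idem e -> z * e = z * e * z^-1 * z.
Proof.
move=> ee; rewrite -!mulA (idemC ee (idem_Vmul z)).
by rewrite !mulA mulVK.
Qed.

Lemma nle_mul2l z x y : nle x y -> nle (z * x) (z * y).
Proof.
move=> [e ee ->]; exists (z * e * z^-1); first exact: idem_conj.
by rewrite mulA [in RHS]mulA -mul_idem_conj.
Qed.

Lemma nle_idemr x e : idem e -> nle (x * e) x.
Proof.
move=> ee; exists (x * e * x^-1); first exact: idem_conj.
exact: mul_idem_conj.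
Qed.

(** The witness of [nle x y] can always be chosen canonically, depending on [x] alone. *)
Lemma nle_idemE x y : nle x y -> x = x * x^-1 * y.
Proof.
move=> [e ee ->]; rewrite invM (idem_inv ee).
transitivity (e * ((y * y^-1) * e) * y); last by rewrite !mulA.
by rewrite (idemC (idem_mulV y) ee) !mulA ee -!mulA (mulA y) mulVK.
Qed.

Lemma nle_mulV x y : nle x y -> x * x^-1 = x * y^-1.
Proof.
move=> [e ee xE].
have -> : x^-1 = y^-1 * e by rewrite xE invM (idem_inv ee).
by rewrite xE -!mulA (mulA y) (idemC (idem_mulV y) ee) !mulA ee.
Qed.

Lemma nle_mulVl a b t : nle t (a * b) -> nle (a^-1 * t) b.
Proof.
move=> /(nle_mul2l a^-1) le_t; apply: nle_trans le_t _.
by exists (a^-1 * a); [apply: idem_Vmul | rewrite mulA].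
Qed.

Lemma nle_mulVr a b t : nle t (b * a) -> nle (t * a^-1) b.
Proof.
move=> /(nle_mul2r a^-1) le_t; apply: nle_trans le_t _.
by rewrite -mulA; apply/nle_idemr/idem_mulV.
Qed.

(** The idempotent [a * a^-1] fixes [a * b], and so everything below it, because idempotents
    commute. *)
Lemma nle_mulKl a b t : nle t (a * b) -> a * (a^-1 * t) = t.
Proof.
move=> [e ee ->]; rewrite !mulA (idemC (idem_mulV a) ee).
by rewrite -(mulA e) mulVK.
Qed.

Lemma nle_mulKr a b t : nle t (b * a) -> t * a^-1 * a = t.
Proof. by move=> [e ee ->]; rewrite -!mulA (mulA a) mulVK. Qed.

Lemma mul_spow_id g a n : 0 < n -> g * a = g -> g * spow mul a n = g.
Proof.
case: n => // n _ ga; rewrite /spow iteropS.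
by elim: n => //= n IHn; rewrite mulA ga.
Qed.

(** Positivity matters: the junk value at 0 is [a], which is also the first power. *)
Lemma spowS a n : 0 < n -> spow mul a n.+1 = a * spow mul a n.
Proof. by case: n. Qed.

Lemma spowSr a n : 0 < n -> spow mul a n.+1 = spow mul a n * a.
Proof.
case: n => // n _; rewrite /spow !iteropS.
by elim: n => //= n IHn; rewrite -mulA -IHn.
Qed.

Section Aperiodic.

Context {n : nat}.
Hypothesis n_gt0 : 0 < n.
Hypothesis pow_stable : forall a : S, spow mul a n = spow mul a n.+1.

Local Notation add := (oplus mul inv n).

Lemma mul_spow a : a * spow mul a n = spow mul a n.
Proof. by rewrite -spowS. Qed.

Lemma spow_mul a : spow mul a n * a = spow mul a n.
Proof. by rewrite -spowSr. Qed.

(** The power absorbs [a] on its right, hence all the factors of a second copy of itself. *)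
Lemma idem_spow a : idem (spow mul a n).
Proof. exact: mul_spow_id n_gt0 (spow_mul a). Qed.

Lemma oplus_nlel x y : nle (add x y) x.
Proof. by exists (spow mul (x * y^-1) n); first exact: idem_spow. Qed.

(* With [u = p x], both [u u^-1] and [u y^-1] equal the idempotent [p], so
   [u u^-1 = (u y^-1)^-1 = y u^-1] and [u = y (u^-1 u)]. *)
Lemma oplus_nler x y : nle (add x y) y.
Proof.
rewrite /oplus; set p := spow _ _ _; set u := p * x.
have pp : idem p by apply: idem_spow.
have uyV : u * y^-1 = p by rewrite /u -mulA spow_mul.
have uuV : u * u^-1 = p.
  have xxVp : x * x^-1 * p = p by rewrite -[p]mul_spow !mulA mulVK.
  by rewrite /u invM (idem_inv pp) -mulA (mulA x) xxVp pp.
have yuV : y * u^-1 = p by rewrite -(idem_inv pp) -uyV invM invK.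
rewrite -(mulVK u) uuV -yuV -mulA.
exact/nle_idemr/idem_Vmul.
Qed.

Lemma nle_oplus t x y : nle t x -> nle t y -> nle t (add x y).
Proof.
(* Here [t * t^-1] absorbs [x * y^-1]: multiplying it by [x] gives [t], and [t * y^-1] is [t * t^-1]
   again. So it absorbs the power as well, leaving [t * t^-1 * x], which is [t]. *)
move=> tx ty; exists (t * t^-1); first exact: idem_mulV.
rewrite /oplus mulA mul_spow_id //; first exact: nle_idemE.
by rewrite mulA -nle_idemE // -nle_mulV.
Qed.

Lemma oplus_semilattice : is_semilattice add.
Proof.
split=> [x y z | x y | x].
(* Each law holds because both sides are greatest lower bounds of the same elements. *)
- apply: nle_anti.
    apply: nle_oplus; last exact: nle_trans (oplus_nler _ _) (oplus_nler _ _).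
    apply: nle_oplus; first exact: oplus_nlel.
    exact: nle_trans (oplus_nler _ _) (oplus_nlel _ _).
  apply: nle_oplus; first exact: nle_trans (oplus_nlel _ _) (oplus_nlel _ _).
  apply: nle_oplus; last exact: oplus_nler.
  exact: nle_trans (oplus_nlel _ _) (oplus_nler _ _).
- by apply: nle_anti; apply: nle_oplus;
    (apply: oplus_nlel || apply: oplus_nler).
- apply: nle_anti; first exact: oplus_nlel.
  by apply: nle_oplus; apply: nle_refl.
Qed.

Lemma oplus_mulDr : right_distributive mul add.
Proof.
move=> a b c; apply: nle_anti.
  by apply: nle_oplus; apply: nle_mul2l; [apply: oplus_nlel | apply: oplus_nler].
have lel := oplus_nlel (a * b) (a * c); have ler := oplus_nler (a * b) (a * c).
(* The sum [t] of [a * b] and [a * c] is rewritten as [a * (a^-1 * t)]; then [a^-1 * t] lies below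
   [b] and [c], hence below their meet. *)
rewrite -(nle_mulKl lel); apply: nle_mul2l.
by apply: nle_oplus; apply: nle_mulVl.
Qed.

Lemma oplus_mulDl : left_distributive mul add.
Proof.
move=> b c a; apply: nle_anti.
  by apply: nle_oplus; apply: nle_mul2r; [apply: oplus_nlel | apply: oplus_nler].
have lel := oplus_nlel (b * a) (c * a); have ler := oplus_nler (b * a) (c * a).
rewrite -(nle_mulKr lel); apply: nle_mul2r.
by apply: nle_oplus; apply: nle_mulVr.
Qed.

End Aperiodic.

End InverseSemigroup.

Theorem lemma1 (S : Type) (mul : S -> S -> S) (inv : S -> S) (n : nat)
    (inverse_S : is_inverse_semigroup mul inv)
    (n_gt0 : 0 < n)
    (pow_stable : forall a : S, spow mul a n = spow mul a n.+1) :
  is_ai_semiring (oplus mul inv n) mul.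
Proof.
split.
- exact: oplus_semilattice.
- exact: inverse_semigroup_mulA inverse_S.
- exact: oplus_mulDr.
- exact: oplus_mulDl.
Qed.
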